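(* There exists an absolute constant $C>0$ such that the following holds. Let $G$ be a finite graph, let $w$ and $u$ be vertices of $G$, and let $R_{w,u}$ be the electric resistance between $w$ and $u$. Then $$R_{w,u}\leq C\,(L_{w}+L_{u}),$$ where for a vertex $v$ of $G$ $$L_{v}:=\sum_{n=1}^{\lfloor \log |G|\rfloor}\ \max_{\substack{v\in A\subseteq G\\ A\text{ connected}\\ |G|2^{-(n+1)}<|A|\leq |G|2^{-n}}}\left(\frac{|A|}{|\partial A|^{2}}+\frac{1}{|\partial A|}\right).$$
   Context: Graphs are undirected. $|G|$ is the number of vertices of $G$, and $\log$ is the logarithm to base $2$. The graph is viewed as an electrical network in which every edge is a one Ohm resistor, and $R_{w,u}$ is the effective resistance between $w$ and $u$ in this network; $R_{w,u}=\infty$ if $w$ and $u$ lie in different connected components of $G$. $G$ is not assumed connected. Sets $A$ are sets of vertices, and ''connected'' means that the induced subgraph on $A$ is connected. For a set $A$ of vertices, $\partial A$ denotes the external (vertex) boundary, i.e. the set of vertices of $G\setminus A$ having a neighbor in $A$. Conventions: the quantities take values in $[0,\infty]$; if $|\partial A|=0$, the expression $\frac{|A|}{|\partial A|^{2}}+\frac{1}{|\partial A|}$ is $\infty$; a maximum over an empty family of sets is taken to be $0$. *)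

(* Defs.v *)
From HB Require Import structures.
From mathcomp Require Import all_boot all_order all_algebra.
From mathcomp Require Import all_classical all_reals.
From mathcomp Require Import ring.

Set Implicit Arguments.
Unset Strict Implicit.
Unset Printing Implicit Defensive.

Import Order.TTheory GRing.Theory Num.Theory.
Local Open Scope ring_scope.

(* A finite simple graph is a finType T of vertices together with a symmetric
   irreflexive adjacency relation e : rel T. *)

(* By Ohm's law the current through a unit resistor from x to y under the
   potential V is V x - V y; this is the total current leaving x. *)
Definition net_current (R : realType) (T : finType) (e : rel T)
    (V : T -> R) (x : T) : R :=
  \sum_(y | e x y) (V x - V y).

(* V is a potential driving a unit current into the network at w and out of it
   at u (Kirchhoff's current law). *)
Definition unit_potential (R : realType) (T : finType) (e : rel T)
    (w u : T) (V : T -> R) : Prop :=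
  forall x, net_current e V x = (x == w)%:R - (x == u)%:R.

(* The choice of V is immaterial, and the default value of xget is never used:
   see unit_potential_exists and eff_resistanceE below. *)
Definition eff_resistance (R : realType) (T : finType) (e : rel T)
    (w u : T) : \bar R :=
  if connect e w u then
    let V := xget (fun=> 0) [set V : T -> R | unit_potential e w u V]%classic in
    (V w - V u)%:E
  else +oo%E.

Definition induced_connected (T : finType) (e : rel T) (A : {set T}) : bool :=
  [forall x in A, forall y in A,
     connect [rel a b | [&& a \in A, b \in A & e a b]] x y].

Definition ext_boundary (T : finType) (e : rel T) (A : {set T}) : {set T} :=
  [set x | (x \notin A) && [exists y in A, e x y]].

Definition iso_term (R : realType) (T : finType) (e : rel T)
    (A : {set T}) : \bar R :=
  let b := #|ext_boundary e A| in
  if b == 0%N then +oo%E else (#|A|%:R / b%:R ^+ 2 + 1 / b%:R)%:E.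

(* iso_term is nonnegative, so starting the maximum at 0 only matters when the
   family is empty. *)
Definition iso_max (R : realType) (T : finType) (e : rel T)
    (v : T) (n : nat) : \bar R :=
  \big[maxe/0%E]_(A : {set T} |
      [&& v \in A, induced_connected e A,
          #|T|%:R / 2 ^+ n.+1 < #|A|%:R :> R
        & #|A|%:R <= #|T|%:R / 2 ^+ n :> R]) iso_term R e A.

Definition iso_sum (R : realType) (T : finType) (e : rel T) (v : T) : \bar R :=
  (\sum_(1 <= n < (trunc_log 2 #|T|).+1) iso_max R e v n)%E.

Lemma sum_net_current (R : realType) (T : finType) (e : rel T)
    (V W : T -> R) : symmetric e ->
  \sum_x W x * net_current e V x =
  2^-1 * \sum_x \sum_(y | e x y) (W x - W y) * (V x - V y).
Proof.
move=> es; pose S := \sum_x \sum_(y | e x y) W x * (V x - V y).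
have -> : \sum_x W x * net_current e V x = S.
  by apply: eq_bigr => x _; rewrite mulr_sumr.
suff -> : \sum_x \sum_(y | e x y) (W x - W y) * (V x - V y) = S + S.
  by rewrite -mulr2n -[S *+ 2]mulr_natl mulKf ?pnatr_eq0.
have {2}-> : S = \sum_x \sum_(y | e x y) - W y * (V x - V y).
  rewrite /S (exchange_big_dep xpredT) //=; apply: eq_bigr => x _.
  apply: eq_big => [y|y _]; first exact: es.
  by rewrite mulNr -mulrN opprB.
rewrite -big_split /=; apply: eq_bigr => x _; rewrite -big_split /=.
by apply: eq_bigr => y _; rewrite mulrDl.
Qed.

Lemma harmonic_connect (R : realType) (T : finType) (e : rel T)
    (V : T -> R) : symmetric e -> (forall x, net_current e V x = 0) ->
  forall x y, connect e x y -> V x = V y.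
Proof.
move=> es V0.
have h a b : 0 <= (V a - V b) * (V a - V b) by rewrite -expr2 sqr_ge0.
have /eqP : \sum_x \sum_(y | e x y) (V x - V y) * (V x - V y) = 0.
  have S0 : \sum_x V x * net_current e V x = 0.
    by apply: big1 => x _; rewrite V0 mulr0.
  have /esym/eqP := sum_net_current V V es.
  by rewrite S0 mulf_eq0 invr_eq0 pnatr_eq0 /= => /eqP.
rewrite psumr_eq0; last by move=> x _; apply: sumr_ge0.
move=> /allP H x y /connectP [p + ->].
elim: p x => //= z p IH x /andP[exz /IH <-].
have := H x (mem_index_enum x); rewrite /= psumr_eq0 //.
move=> /allP /(_ z (mem_index_enum z)); rewrite exz /= -expr2 sqrf_eq0 subr_eq0.
by move/eqP.
Qed.

Lemma unit_potential_exists (R : realType) (T : finType) (e : rel T)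
    (w u : T) : symmetric e -> connect e w u ->
  exists V : T -> R, unit_potential e w u V.
Proof.
move=> es cwu; pose n := #|T|.
pose vec (f : T -> R) : 'rV[R]_n := \row_i f (enum_val i).
pose L : 'M[R]_n := \matrix_(i, j) net_current e
   (fun x => (x == enum_val i)%:R) (enum_val j).
have LE (V : T -> R) x :
    net_current e V x = \sum_z V z * net_current e (fun y => (y == z)%:R) x.
  have VE y : V y = \sum_z V z * (y == z)%:R.
    rewrite (bigD1 y) //= eqxx mulr1 big1 ?addr0 // => z /negPf.
    by rewrite eq_sym => ->; rewrite mulr0.
  under [RHS]eq_bigr do rewrite mulr_sumr.
  rewrite exchange_big /=; apply: eq_bigr => y _.
  rewrite [in LHS](VE x) [in LHS](VE y) -sumrB.
  by apply: eq_bigr => z _; rewrite mulrBr.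
have LS a b : net_current e (fun y => (y == a)%:R) b =
              net_current e (fun y => (y == b)%:R) a :> R.
  have E (f : T -> R) c : f c = \sum_x (x == c)%:R * f x.
    rewrite (bigD1 c) //= eqxx mul1r big1 ?addr0 // => z /negPf ->.
    by rewrite mul0r.
  rewrite [LHS]E [RHS]E !sum_net_current //; congr (_ * _).
  by apply: eq_bigr => x _; apply: eq_bigr => y _; rewrite mulrC.
pose d := vec (fun x => (x == w)%:R - (x == u)%:R).
have /submxP[D dE] : (d <= L)%MS.
  rewrite submxE; apply/eqP/rowP => k; rewrite !mxE.
  pose K x := cokermx L (enum_rank x) k.
  have K0 x : net_current e K x = 0.
    rewrite LE; have /matrixP/(_ (enum_rank x) k) := mulmx_coker L.
    rewrite !mxE => S0; rewrite -[RHS]S0 (reindex (@enum_val T T)) /=; last first.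
      by apply: onW_bij; apply: enum_val_bij.
    by apply: eq_bigr => i _; rewrite [L _ _]mxE enum_rankK LS /K enum_valK mulrC.
  have Kwu := harmonic_connect es K0 cwu.
  transitivity (\sum_x ((x == w)%:R - (x == u)%:R) * K x).
    rewrite [RHS](reindex (@enum_val T T)) /=; last first.
      by apply: onW_bij; apply: enum_val_bij.
    by apply: eq_bigr => i _; rewrite [d _ _]mxE /K enum_valK.
  have E c : \sum_x (x == c)%:R * K x = K c.
    rewrite (bigD1 c) //= eqxx mul1r big1 ?addr0 // => z /negPf ->.
    by rewrite mul0r.
  by under eq_bigr do rewrite mulrBl; rewrite sumrB !E Kwu subrr.
exists (fun x => D 0 (enum_rank x)) => x; rewrite LE.
have /rowP/(_ (enum_rank x)) := dE; rewrite !mxE enum_rankK => ->.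
rewrite (reindex (@enum_val T T)) /=; last first.
  by apply: onW_bij; apply: enum_val_bij.
by apply: eq_bigr => i _; rewrite !mxE enum_rankK enum_valK.
Qed.

Lemma eff_resistanceE (R : realType) (T : finType) (e : rel T)
    (w u : T) (V : T -> R) : symmetric e -> connect e w u ->
  unit_potential e w u V -> eff_resistance R e w u = (V w - V u)%:E.
Proof.
move=> es cwu hV; rewrite /eff_resistance cwu.
case: xgetP => [V' _ /= hV'|/(_ V)/(_ hV)//].
have h0 x : net_current e (fun z => V' z - V z) x = 0.
  have -> : net_current e (fun z => V' z - V z) x =
            net_current e V' x - net_current e V x.
    rewrite /net_current -sumrB; apply: eq_bigr => y _.
    by rewrite !opprD !opprK addrACA.
  by rewrite hV' hV subrr.
have /eqP := harmonic_connect es h0 cwu.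
by rewrite subr_eq => /eqP ->; congr EFin; ring.
Qed.

(* Main.v *)
Require Import Defs.
From HB Require Import structures.
From mathcomp Require Import all_boot all_order all_algebra.
From mathcomp Require Import all_classical all_reals.
From mathcomp Require Import ring lra zify.

Set Implicit Arguments.
Unset Strict Implicit.
Unset Printing Implicit Defensive.

Import Order.TTheory GRing.Theory Num.Theory.
Local Open Scope ring_scope.

(* Let V be a potential for the unit current from w to u, and let A be the set
   of vertices where V >= t.  By the maximum principle A is connected, and at
   most a unit current leaves it.  If b is the size of the boundary of A, then
   at most b / 2 boundary vertices can have V < t - 2 / b, so lowering t by
   2 / b adds at least b / 2 vertices to A.  Hence A doubles its size after a
   drop of potential that is at most a multiple of |A| / b^2 + 1 / b; summing
   over the dyadic scales, a drop of order L_w suffices for A to contain more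
   than half of the vertices.  The same holds around u for - V, and two sets
   that contain more than half of the vertices intersect. *)

(** * Superlevel sets of a potential *)

(** Restricted to the component of [w], because the level of [V] on other components is arbitrary;
    thus a vertex common to the sets of [w] and [u] also yields a path from [w] to [u]. *)
Definition superlevel (R : realType) (T : finType) (e : rel T) (w : T)
    (V : T -> R) (t : R) : {set T} :=
  [set x | connect e w x && (t <= V x)].

(* An upper bound on the sources is all that the argument uses; unlike
   [unit_potential e w u], it is also satisfied by the constant potentials,
   which deal with disconnected graphs. *)
Definition sub_unit_potential (R : realType) (T : finType) (e : rel T)
    (w : T) (V : T -> R) : Prop :=
  forall x, net_current e V x <= (x == w)%:R.

(** An edge with both ends in [Z] contributes two opposite currents, which cancel. *)
Lemma sum_net_current_cut (R : realType) (T : finType) (e : rel T)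
    (V : T -> R) (Z : {set T}) : symmetric e ->
  \sum_(x in Z) net_current e V x =
  \sum_(x in Z) \sum_(y | (y \notin Z) && e x y) (V x - V y).
Proof.
move=> es.
pose S := \sum_(x in Z) \sum_(y | (y \in Z) && e x y) (V x - V y).
have SN : S = - S.
  rewrite {1}/S (exchange_big_dep (mem Z)) /=; last by move=> x y _ /andP[].
  rewrite /S -sumrN; apply: eq_bigr => y yZ; rewrite -sumrN.
  by apply: eq_big => [x|x _]; [rewrite yZ es | rewrite opprB].
have S0 : S = 0 by lra.
transitivity (S + \sum_(x in Z) \sum_(y | (y \notin Z) && e x y) (V x - V y)).
  rewrite -big_split /=; apply: eq_bigr => x _.
  rewrite /net_current (bigID (mem Z)) /=.
  by congr (_ + _); apply: eq_bigl => y; rewrite andbC.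
by rewrite S0 add0r.
Qed.

Lemma sum_indicator_le1 (R : realType) (T : finType) (Z : {set T}) (w : T) :
  \sum_(x in Z) (x == w)%:R <= (w \in Z)%:R :> R.
Proof.
have [wZ|wZ] := boolP (w \in Z).
  rewrite (bigD1 w) //= eqxx big1 ?addr0 // => x /andP[_ /negPf ->].
  by [].
by rewrite big1 // => x xZ; case: eqP xZ wZ => // -> ->.
Qed.

(** Maximum principle: let [Z] be the part of the set not reachable from [w] inside it. All edges
    leaving [Z] go strictly downhill, yet [Z] contains no source, so no edge leaves [Z]. As the
    graph joins each vertex of [Z] to [w], [Z] is empty. *)
Lemma superlevel_connected (R : realType) (T : finType) (e : rel T) (w : T)
    (V : T -> R) (t : R) : symmetric e -> sub_unit_potential e w V ->
  t <= V w -> induced_connected e (superlevel e w V t).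
Proof.
move=> es hV tw; set A := superlevel e w V t.
pose r := [rel a b | [&& a \in A, b \in A & e a b]].
have rs : connect_sym r.
  by apply: sym_connect_sym => a b /=; rewrite es andbCA.
have wA : w \in A by rewrite inE connect0.
suff AK : forall x, x \in A -> connect r w x.
  apply/forallP => x; apply/implyP => xA; apply/forallP => y.
  apply/implyP => yA; apply: connect_trans (AK y yA).
  by rewrite rs AK.
pose Z := [set x in A | ~~ connect r w x].
(* If [b] were in [A], it would be reachable inside [A], and so would [a]; hence [V b < t]. *)
have Zout a b : a \in Z -> b \notin Z -> e a b -> V b < V a.
  rewrite !inE => /andP[/andP[wa ta] nra] + eab.
  have wb : connect e w b by apply: connect_trans wa (connect1 eab).
  rewrite wb /=; have [tb|bt _] := leP t (V b); last exact: lt_le_trans ta.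
  rewrite /= negbK => rb; case/negP: nra; apply: connect_trans rb (connect1 _).
  by rewrite /= !inE wa wb ta tb es.
have Zw : w \notin Z by rewrite inE connect0 andbF.
have Zclosed a b : a \in Z -> e a b -> b \in Z.
  move=> aZ eab; apply: contraT => bZ.
  have : \sum_(x in Z) net_current e V x <= 0.
    apply: le_trans (_ : \sum_(x in Z) (x == w)%:R <= 0); first exact: ler_sum.
    by have := sum_indicator_le1 R Z w; rewrite (negPf Zw).
  have pos z y : z \in Z -> (y \notin Z) && e z y -> 0 <= V z - V y.
    by move=> zZ /andP[yZ ezy]; rewrite subr_ge0 ltW // Zout.
  rewrite sum_net_current_cut // (bigD1 a) //= (bigD1 b) /=; last by rewrite bZ.
  have := Zout _ _ aZ bZ eab.
  set s1 := \sum_(_ | _) _; set s2 := \sum_(_ | _) _.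
  have : 0 <= s1 by apply: sumr_ge0 => y /andP[] /(pos _ _ aZ).
  have : 0 <= s2.
    by apply: sumr_ge0 => x /andP[xZ _]; apply: sumr_ge0 => y /(pos _ _ xZ).
  lra.
move=> x xA; apply: contraT => nx.
have xZ : x \in Z by rewrite inE xA.
have : connect e x w.
  by rewrite (sym_connect_sym es); move: xA; rewrite inE => /andP[].
move=> /connectP[p + wE]; rewrite wE in Zw; move: Zw; clear -Zclosed xZ.
elim: p x xZ => [|z p IH] x xZ /=; first by rewrite xZ.
by move=> lZ /andP[/(Zclosed _ _ xZ) zZ /(IH _ zZ)]; apply.
Qed.

(** At most a unit current leaves [A], and a boundary vertex below [t - 2 / b] receives at least
    [2 / b] of it. So there are at most [b / 2] such vertices, and the rest of the boundary joins
    the set. *)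
Lemma superlevel_grow (R : realType) (T : finType) (e : rel T) (w : T)
    (V : T -> R) (t : R) : symmetric e -> sub_unit_potential e w V ->
  let A := superlevel e w V t in
  let b := #|ext_boundary e A|%:R in
  0 < b ->
  #|A|%:R + b / 2 <= #|superlevel e w V (t - 2 / b)|%:R :> R.
Proof.
move=> es hV A b b0.
pose B := [set y in ext_boundary e A | V y < t - 2 / b].
have out x y : x \in A -> y \notin A -> e x y -> V y < t <= V x.
  rewrite !inE => /andP[wx tx] + exy.
  by rewrite tx (connect_trans wx (connect1 exy)) /= andbT ltNge.
have A1 : \sum_(x in A) net_current e V x <= 1.
  apply: le_trans (_ : \sum_(x in A) (x == w)%:R <= 1); first exact: ler_sum.
  by apply: le_trans (sum_indicator_le1 R A w) _; rewrite lern1 leq_b1.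
(* The current that flows from [A] into [y]. *)
pose f y := \sum_(x | (x \in A) && e x y) (V x - V y).
have pos x y : y \notin A -> (x \in A) && e x y -> 0 <= V x - V y.
  by move=> yA /andP[xA exy]; have := out _ _ xA yA exy; lra.
have f0 y : y \notin A -> 0 <= f y.
  by move=> yA; apply: sumr_ge0 => x; apply: pos.
have fB y : y \in B -> 2 / b <= f y.
  rewrite 2!inE -andbA => /and3P[yA /existsP[x /andP[xA]]].
  rewrite es => exy yt.
  rewrite /f (bigD1 x) /=; last by rewrite xA.
  have := out _ _ xA yA exy; set s := \sum_(_ | _) _.
  have : 0 <= s by apply: sumr_ge0 => z /andP[] /(pos _ _ yA).
  move: yt; lra.
have BA y : y \in B -> y \notin A by rewrite 2!inE -andbA => /and3P[].
have Bb : #|B|%:R * (2 / b) <= 1.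
  apply: le_trans A1; rewrite sum_net_current_cut //.
  rewrite (exchange_big_dep (fun y => y \notin A)) /=; last first.
    by move=> x y _ /andP[].
  have -> : \sum_(y | y \notin A)
      \sum_(x | (x \in A) && ((y \notin A) && e x y)) (V x - V y) =
      \sum_(y | y \notin A) f y.
    by apply: eq_bigr => y yA; apply: eq_bigl => x; rewrite yA.
  rewrite (bigID (mem B)) /= -[X in X <= _]addr0; apply: lerD; last first.
    by apply: sumr_ge0 => y /andP[/f0].
  rewrite mulr_natl -sumr_const.
  rewrite [X in _ <= X](eq_bigl (mem B)); last first.
    by move=> y /=; case yB: (y \in B); rewrite ?andbF // (BA _ yB).
  exact: ler_sum.
have {}Bb : #|B|%:R <= b / 2.
  by move: Bb; rewrite mulrA ler_pdivrMr // mul1r; lra.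
have sub : A :|: (ext_boundary e A :\: B) \subset superlevel e w V (t - 2 / b).
  have b20 : 0 <= 2 / b by rewrite divr_ge0 // ltW.
  apply/fintype.subsetP => y.
  rewrite finset.in_setU finset.in_setD => /orP[|/andP[]].
    by rewrite !inE => /andP[-> /=]; lra.
  rewrite [y \in B]inE => + yb; rewrite yb /= -leNgt => ty.
  move: yb; rewrite !inE => /andP[_ /existsP[x /andP[]]].
  rewrite inE es => /andP[wx _] exy.
  by rewrite (connect_trans wx (connect1 exy)).
have BsubE : B \subset ext_boundary e A.
  by apply/fintype.subsetP => y; rewrite inE => /andP[].
have := subset_leq_card sub.
have -> : #|A :|: (ext_boundary e A :\: B)| =
    (#|A| + #|ext_boundary e A :\: B|)%N.
  apply/eqP; rewrite (leq_card_setU A (ext_boundary e A :\: B)).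
  rewrite finset.disjoints_subset.
  apply/fintype.subsetP => y yA.
  by rewrite finset.in_setC finset.in_setD [y \in ext_boundary _ _]inE yA andbF.
rewrite cardsD (finset.setIidPr BsubE) -(ler_nat R) natrD.
rewrite natrB ?subset_leq_card //.
rewrite -/b; lra.
Qed.

(** * Potential drop across the dyadic scales *)

Lemma iso_term_fin (R : realType) (T : finType) (e : rel T) (A : {set T})
    (M : R) :
  (iso_term R e A <= M%:E)%E ->
  0 < #|ext_boundary e A|%:R :> R /\
  #|A|%:R / #|ext_boundary e A|%:R ^+ 2 + 1 / #|ext_boundary e A|%:R <= M.
Proof.
by rewrite /iso_term; case: eqP => [//|/eqP b0]; rewrite lee_fin ltr0n lt0n.
Qed.

Lemma iso_term_ge0 (R : realType) (T : finType) (e : rel T) (A : {set T}) :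
  (0 <= iso_term R e A)%E.
Proof.
rewrite /iso_term; case: ifP => _; first exact: leey.
by rewrite lee_fin addr_ge0 // divr_ge0 // exprn_ge0.
Qed.

Lemma iso_max_ge0 (R : realType) (T : finType) (e : rel T) (v : T) (n : nat) :
  (0 <= iso_max R e v n)%E.
Proof.
rewrite /iso_max; elim/big_ind: _ => // [x y x0 y0|A _].
  by rewrite le_max x0.
exact: iso_term_ge0.
Qed.

(** Iterates [superlevel_grow], each time at cost [2 / b]. The step that overshoots size [2 * s]
    costs at most [2 * M] by the term [1 / b]. By the other term, the earlier steps cost at most
    [4 * M / s] per vertex gained, hence at most [4 * M] in total. *)
Lemma superlevel_class (R : realType) (T : finType) (e : rel T) (w : T)
    (V : T -> R) (n : nat) (M t : R) : symmetric e ->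
  sub_unit_potential e w V -> (iso_max R e w n <= M%:E)%E -> t <= V w ->
  #|T|%:R / 2 ^+ n.+1 < #|superlevel e w V t|%:R :> R ->
  exists t', [/\ t' <= t, t - t' <= 6 * M &
    #|T|%:R / 2 ^+ n < #|superlevel e w V t'|%:R :> R].
Proof.
move=> es hV hM; pose s : R := #|T|%:R / 2 ^+ n.+1.
have s2 : #|T|%:R / 2 ^+ n = 2 * s.
  by rewrite /s exprS; field; rewrite expf_neq0 ?pnatr_eq0.
have s0 : 0 < s.
  by rewrite divr_gt0 ?exprn_gt0 // ltr0n; apply/card_gt0P; exists w.
have M0 : 0 <= M by rewrite -lee_fin (le_trans (iso_max_ge0 R e w n)).
rewrite s2 -/s.
(* Induction on the number of vertices outside the set; the bound records the room left below size
   [2 * s], so that the costs telescope. *)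
suff H k t1 : (#|T| - #|superlevel e w V t1| < k)%N -> t1 <= V w ->
    s < #|superlevel e w V t1|%:R <= 2 * s ->
    exists t', [/\ t' <= t1,
      t1 - t' <= 2 * M + 4 * M / s * (2 * s - #|superlevel e w V t1|%:R) &
      2 * s < #|superlevel e w V t'|%:R].
  move=> tw sA; case: (leP #|superlevel e w V t|%:R (2 * s)) => As.
    case: (H _ _ (ltnSn _) tw _) => [|t' [t't dt st']]; first by rewrite sA.
    exists t'; split => //; apply: le_trans dt _.
    have : 4 * M / s * (2 * s - #|superlevel e w V t|%:R) <= 4 * M / s * s.
      by apply: ler_wpM2l; [apply: divr_ge0; [lra|exact: ltW] | lra].
    rewrite divfK ?gt_eqF //; lra.
  by exists t; split => //; rewrite subrr mulr_ge0.
elim: k t1 => [//|k IH] t1; set A := superlevel e w V t1 => kA tw /andP[sA As].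
have /iso_term_fin[] : (iso_term R e A <= M%:E)%E.
  apply: le_trans hM; rewrite /iso_max; apply: le_bigmax_cond.
  by rewrite superlevel_connected // s2 As sA inE connect0 tw.
set b := #|_|%:R => b0 hAb.
have := superlevel_grow es hV b0; rewrite -/A -/b.
set t2 := t1 - 2 / b; set A2 := superlevel e w V t2 => grow.
have b20 : 0 < 2 / b by rewrite divr_gt0.
have b2M : 2 / b <= 2 * M.
  have : 0 <= #|A|%:R / b ^+ 2 by rewrite divr_ge0 // exprn_ge0 // ltW.
  by move: hAb; rewrite div1r; lra.
(* Since [s < #|A|], the bound on the isoperimetric term gives [s <= M * b ^+ 2], that is
   [2 / b <= 4 * M / s * (b / 2)], and the set gains at least [b / 2] vertices. *)
have Mb : 2 / b <= 4 * M / s * (#|A2|%:R - #|A|%:R).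
  have sb : s <= M * b ^+ 2.
    rewrite -ler_pdivrMr ?exprn_gt0 //; apply: le_trans hAb.
    apply: le_trans (_ : #|A|%:R / b ^+ 2 <= _).
      by rewrite ler_pM2r ?invr_gt0 ?exprn_gt0 // ltW.
    by rewrite lerDl divr_ge0 // ltW.
  apply: le_trans (_ : 4 * M / s * (b / 2) <= _); last first.
    by apply: ler_wpM2l; [apply: divr_ge0; [lra|exact: ltW] | lra].
  rewrite ler_pdivrMr // -subr_ge0.
  have -> : 4 * M / s * (b / 2) * b - 2 = 2 * (M * b ^+ 2 - s) / s.
    by field; rewrite gt_eqF.
  by rewrite divr_ge0 ?(ltW s0) // mulr_ge0 // subr_ge0.
case: (leP #|A2|%:R (2 * s)) => A2s; last first.
  exists t2; split => //; rewrite /t2; first lra.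
  have : 0 <= 4 * M / s * (2 * s - #|A|%:R).
    by apply: mulr_ge0; [apply: divr_ge0; [lra|exact: ltW] | lra].
  lra.
have AA2 : (#|A| < #|A2|)%N by rewrite -(ltr_nat R); lra.
have [|||t' [t't2 dt st']] := IH t2.
- have A2T : (#|A2| <= #|T|)%N by exact: max_card.
  rewrite -/A2; lia.
- rewrite /t2; lra.
- rewrite -/A2 A2s andbT; lra.
exists t'; split => //; first by rewrite /t2 in t't2; lra.
move: dt; rewrite -/A2 /t2 => dt.
have -> : 4 * M / s * (2 * s - #|A|%:R) =
  4 * M / s * (2 * s - #|A2|%:R) + 4 * M / s * (#|A2|%:R - #|A|%:R) by ring.
lra.
Qed.

(** Runs through the scales from [n = L] down to [n = 1], paying at most [6 * M n] at each;
    finiteness of the sum makes every [M n] finite. *)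
Lemma superlevel_majority (R : realType) (T : finType) (e : rel T) (w : T)
    (V : T -> R) (S : R) : symmetric e -> sub_unit_potential e w V ->
  iso_sum R e w = S%:E ->
  exists2 t, V w - t <= 6 * S & (#|T| < 2 * #|superlevel e w V t|)%N.
Proof.
move=> es hV hS; set L := trunc_log 2 #|T|.
have T0 : (0 < #|T|)%N by apply/card_gt0P; exists w.
pose M n := fine (iso_max R e w n).
have hM n : (0 < n <= L)%N -> iso_max R e w n = (M n)%:E.
  move=> nL; rewrite fineK //.
  have : (iso_max R e w n <= S%:E)%E.
    rewrite -hS /iso_sum (bigD1_seq n) ?iota_uniq //=; last first.
      by rewrite mem_index_iota.
    by apply: leeDl; apply: sume_ge0 => i _; apply: iso_max_ge0.
  by have := iso_max_ge0 R e w n; case: (iso_max R e w n).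
have {hS} -> : S = \sum_(1 <= n < L.+1) M n.
  apply/EFin_inj; rewrite -hS /iso_sum -sumEFin.
  by apply: eq_big_nat => n; rewrite ltnS; apply: hM.
have H k : (k <= L)%N -> exists t, [/\ t <= V w,
    V w - t <= 6 * \sum_((L - k).+1 <= n < L.+1) M n &
    #|T|%:R / 2 ^+ (L - k).+1 < #|superlevel e w V t|%:R :> R].
  elim: k => [_|k IH kL].
    (* The vertex [w] alone is enough to start, as [#|T| < 2 ^ L.+1]. *)
    exists (V w); split => //.
      by rewrite subn0 big_geq // subrr mulr0.
    apply: lt_le_trans (_ : 1 <= _).
      rewrite ltr_pdivrMr ?exprn_gt0 // mul1r subn0 -natrX ltr_nat.
      exact: trunc_log_ltn.
    by rewrite ler1n; apply/card_gt0P; exists w; rewrite inE connect0 lexx.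
  have [t [tw dt tL]] := IH (ltnW kL).
  have Lk : (L - k)%N = (L - k.+1).+1 by lia.
  have Mn : (iso_max R e w (L - k) <= (M (L - k)%N)%:E)%E.
    by rewrite hM //; lia.
  have [t' [t't dt' tL']] := superlevel_class es hV Mn tw tL.
  exists t'; split; first exact: le_trans tw.
    rewrite -Lk big_ltn; last by lia.
    by rewrite mulrDr; lra.
  by rewrite -Lk.
have [t [_ dt tL]] := H L (leqnn L); rewrite subnn in dt tL.
exists t => //; move: tL; rewrite expr1 ltr_pdivrMr // -natrM ltr_nat.
by rewrite mulnC.
Qed.

(** * Combining the bounds at the two vertices *)

Lemma iso_sum_ge0 (R : realType) (T : finType) (e : rel T) (v : T) :
  (0 <= iso_sum R e v)%E.
Proof. by apply: sume_ge0 => n _; apply: iso_max_ge0. Qed.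

Lemma majorities_meet (T : finType) (A B : {set T}) :
  (#|T| < 2 * #|A|)%N -> (#|T| < 2 * #|B|)%N ->
  exists2 x, x \in A & x \in B.
Proof.
move=> hA hB; have /card_gt0P[x] : (0 < #|A :&: B|)%N.
  have : (#|A :|: B| <= #|T|)%N by exact: max_card.
  by have := cardsUI A B; lia.
by rewrite inE => /andP[]; exists x.
Qed.

Lemma net_currentN (R : realType) (T : finType) (e : rel T) (V : T -> R) x :
  net_current e (fun y => - V y) x = - net_current e V x.
Proof.
rewrite /net_current -sumrN; apply: eq_bigr => y _.
by rewrite opprB opprK addrC.
Qed.

Theorem theorem2p1 (R : realType) :
  exists C : R, 0 < C /\
    forall (T : finType) (e : rel T), symmetric e -> irreflexive e ->
    forall w u : T,
      (eff_resistance R e w u <= C%:E * (iso_sum R e w + iso_sum R e u))%E.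
Proof.
exists 6; split => // T e es _ w u.
have := iso_sum_ge0 R e w; have := iso_sum_ge0 R e u.
case Su : (iso_sum R e u) => [su| |] // su0.
all: case Sw : (iso_sum R e w) => [sw| |] // sw0.
all: rewrite ?addye ?addey ?gt0_muley ?leey ?lte_fin //.
rewrite -EFinD -EFinM.
(* With a constant potential, a superlevel set is a whole component or empty, so the components of
   [w] and [u] both hold a majority and coincide. *)
have cuw : connect e w u.
  have h0 v : sub_unit_potential e v (fun=> 0 : R).
    by move=> x; rewrite /net_current big1 // => y _; rewrite subrr.
  have [t _ tw] := superlevel_majority es (h0 w) Sw.
  have [t' _ tu] := superlevel_majority es (h0 u) Su.
  have [x] := majorities_meet tw tu; rewrite !inE => /andP[wx _] /andP[ux _].
  by apply: connect_trans wx _; rewrite (sym_connect_sym es).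
have [V hV] := unit_potential_exists R es cuw.
rewrite (eff_resistanceE es cuw hV) lee_fin.
have hw : sub_unit_potential e w V by move=> x; rewrite hV gerBl.
have hu : sub_unit_potential e u (fun x => - V x).
  by move=> x; rewrite net_currentN hV opprB gerBl.
have [t dt tw] := superlevel_majority es hw Sw.
have [t' dt' tu] := superlevel_majority es hu Su.
(* At the common vertex, [V w - 6 * sw <= V x <= V u + 6 * su]. *)
have [x] := majorities_meet tw tu; rewrite !inE => /andP[_ tx] /andP[_ tx'].
lra.
Qed.
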